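(* Let $\mathbf{X}$ be a (deterministic) $p\times n$ real matrix whose columns have unit Euclidean norm, and let $\mathbf{Y}=\mathbf{H}\mathbf{D}\mathbf{X}$, where $\mathbf{H}\in\mathbb{R}^{p\times p}$ is either an (orthonormal) Hadamard matrix or an (orthonormal) DCT matrix and $\mathbf{D}\in\mathbb{R}^{p\times p}$ is a random diagonal matrix whose diagonal entries are independent and uniform on $\{\pm1\}$. Let $\eta=1$ if $\mathbf{H}$ is a Hadamard matrix and $\eta=1/2$ if $\mathbf{H}$ is a DCT matrix. Then for all $\alpha\in(0,1)$, $$\mathbb{P}\left\{\|\mathbf{Y}\|_{\max}\ge\frac1{\sqrt p}\cdot\sqrt{\frac2\eta\log\Big(\frac{2np}\alpha\Big)}\right\}\le\alpha,$$ $$\mathbb{P}\left\{\|\mathbf{Y}\|_{\text{max-row}}\ge\sqrt{\frac np}\cdot\sqrt{\frac2\eta\log\Big(\frac{2np}\alpha\Big)}\right\}\le\alpha .$$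
   Context: $\|\mathbf{Y}\|_{\max}$ is the maximum absolute value of the entries of $\mathbf{Y}$; $\|\mathbf{Y}\|_{\text{max-row}}$ is the maximum $\ell_2$ norm of its rows. A Hadamard matrix here is normalized to be orthonormal, so its entries are $\pm1/\sqrt p$ (it is assumed to exist for the given $p$); the DCT matrix is the orthonormal discrete cosine transform matrix, whose entries are bounded in absolute value by $\sqrt{2/p}$. *)

(* Defs.v *)
From mathcomp Require Import all_boot all_order all_algebra.
From mathcomp Require Import all_classical all_reals all_analysis.

Set Implicit Arguments.
Unset Strict Implicit.
Unset Printing Implicit Defensive.

Import Order.TTheory GRing.Theory Num.Theory.

Local Open Scope classical_set_scope.
Local Open Scope ring_scope.

(* The maximum absolute entry of a matrix is mx_norm (matrix_normedtype). *)

(* Used on single rows and columns, where it is the Euclidean norm; on a general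
   matrix it is the Frobenius norm. *)
Definition l2norm (R : realType) (m n : nat) (A : 'M[R]_(m, n)) : R :=
  Num.sqrt (\sum_i \sum_j A i j ^+ 2).

Definition max_row_norm (R : realType) (m n : nat) (A : 'M[R]_(m, n)) : R :=
  \big[Num.max/0]_(i < m) l2norm (row i A).

(* Hadamard matrices normalized to be orthonormal, as opposed to the usual
   convention with entries 1 and -1. *)
Definition orthonormal_hadamard (R : realType) (p : nat) (H : 'M[R]_p) : Prop :=
  (forall i j, H i j = (Num.sqrt p%:R)^-1 \/ H i j = - (Num.sqrt p%:R)^-1)
  /\ H *m H^T = 1%:M.

(* The orthonormal DCT-II; row index k is the frequency, column index j the
   sample. Its entries are bounded by sqrt (2 / p) in absolute value. *)
Definition dct_mx (R : realType) (p : nat) : 'M[R]_p :=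
  \matrix_(k, j)
    (Num.sqrt ((if k == 0%N :> nat then 1 else 2) / p%:R) *
     cos (pi * (2 * j%:R + 1) * k%:R / (2 * p%:R))).

(* Mutual independence: the product rule holds over every finite subfamily. *)
Definition mutually_independent (R : realType) (d : measure_display)
    (T : measurableType d) (P : probability T R) (I : finType)
    (eps : I -> {RV P >-> R}) : Prop :=
  forall (J : {set I}) (B : I -> set R),
    (forall i, measurable (B i)) ->
    P (\bigcap_(i in [set` J]) (eps i @^-1` B i)) =
    (\prod_(i in J) P (eps i @^-1` B i))%E.

Definition uniform_sign (R : realType) (d : measure_display)
    (T : measurableType d) (P : probability T R) (e : {RV P >-> R}) : Prop :=
  P (e @^-1` [set 1]) = (2^-1)%:E /\ P (e @^-1` [set -1]) = (2^-1)%:E.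

Definition sign_diag_mx (R : realType) (d : measure_display)
    (T : measurableType d) (P : probability T R) (p : nat)
    (eps : 'I_p -> {RV P >-> R}) (w : T) : 'M[R]_p :=
  diag_mx (\row_i eps i w).

(* Main.v *)
Require Import Defs.
From mathcomp Require Import all_boot all_order all_algebra.
From mathcomp Require Import all_classical all_reals all_analysis.
From mathcomp Require Import measurable_realfun ring lra.

(* Each entry of Y is a Rademacher sum whose weights have squared norm at most
   v = 1 / (eta p), because H has squared entries at most v and X has unit
   columns.  The sign vector is almost surely one of 2 ^ p equally likely
   vectors, so the Chernoff method (with cosh x <= exp (x ^ 2 / 2)) becomes a
   weighted count and gives the tail bound 2 exp (- t ^ 2 / (2 v)).  The union
   bound over the n p entries gives the first claim; the second event is
   contained in the first, since a row of norm at least sqrt n * t has an entry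
   of absolute value at least t. *)

Set Implicit Arguments.
Unset Strict Implicit.
Unset Printing Implicit Defensive.

Import Order.TTheory GRing.Theory Num.Theory.
Import numFieldNormedType.Exports.

Local Open Scope classical_set_scope.
Local Open Scope ring_scope.

(** * The comparison of cosh with a Gaussian exponential *)

Lemma is_derive_le0_le_at0 (R : realType) (f f' : R -> R) :
  (forall x : R, is_derive x 1 f (f' x)) -> (forall x, 0 < x -> f' x <= 0) ->
  forall x, 0 <= x -> f x <= f 0.
Proof.
move=> df f'_le0 x x_ge0.
apply: (@ler0_derive1_nincry _ f 0) => //.
- move=> y; rewrite in_itv /= andbT => y_gt0.
  by rewrite derive1E (@derive_val _ _ _ _ _ _ _ (df y)) f'_le0.
- apply: continuous_subspaceT => y.
  by apply/differentiable_continuous/derivable1_diffP.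
Qed.

(** Both sides are even, so [0 <= x] may be assumed. Moving the Gaussian factor to the left gives
    [h], whose derivative has the sign of [k]; in turn [k] vanishes at 0 and has derivative
    [- z * (expR z - expR (- z))], so [h] decreases from [h 0 = 2]. *)
Lemma expRD_expRN_le (R : realType) (x : R) :
  expR x + expR (- x) <= 2 * expR (x ^+ 2 / 2).
Proof.
wlog x_ge0 : x / 0 <= x => [th|].
  have [|/ltW x_le0] := leP 0 x; first exact: th.
  by rewrite addrC -sqrrN -{2}[x]opprK th // oppr_ge0.
pose k y : R := (1 - y) * expR y - (1 + y) * expR (- y).
have k_le0 y : 0 <= y -> k y <= 0.
  move=> y_ge0; have -> : 0 = k 0 by rewrite /k oppr0 !expR0; ring.
  apply: (@is_derive_le0_le_at0 _ k (fun z => - z * (expR z - expR (- z)))) => //.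
    move=> z; rewrite /k; apply: is_derive_eq.
    by rewrite /GRing.scale /=; ring.
  move=> z z_gt0; rewrite mulNr oppr_le0 mulr_ge0 ?(ltW z_gt0)//.
  by rewrite subr_ge0 ler_expR; lra.
pose h y : R := (expR y + expR (- y)) * expR (- (y * y / 2)).
have h_le : h x <= h 0.
  apply: (@is_derive_le0_le_at0 _ h (fun y => k y * expR (- (y * y / 2)))) => //.
    move=> y; rewrite /h; apply: is_derive_eq.
    by rewrite /GRing.scale /= /k; field.
  by move=> y /ltW y_ge0; rewrite mulr_le0_ge0 ?k_le0 ?expR_ge0.
have h0 : h 0 = 2 by rewrite /h !mul0r !oppr0 expR0; ring.
by move: h_le; rewrite h0 /h (expRN (_ / 2)) ler_pdivrMr ?expR_gt0// expr2.
Qed.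

(** * From independent signs to counting sign vectors *)

Lemma probability_le_sum (R : realType) (d : measure_display)
    (T : measurableType d) (P : probability T R) (I : finType) (Q : pred I)
    (A : set T) (F : I -> set T) :
  measurable A -> (forall i, measurable (F i)) ->
  (forall w, A w -> exists2 i, Q i & F i w) ->
  (P A <= \sum_(i | Q i) P (F i))%E.
Proof.
move=> mA mF AF.
rewrite (@bigfs _ _ _ _ (index_enum I)) ?index_enum_uniq//; last first.
  by move=> i _; rewrite mem_index_enum.
exact: content_sub_fsum.
Qed.

Lemma uniform_sign_null (R : realType) (d : measure_display)
    (T : measurableType d) (P : probability T R) (e : {RV P >-> R}) :
  uniform_sign e -> P (~` (e @^-1` [set 1] `|` e @^-1` [set -1])) = 0%E.
Proof.
move=> [e1 eN1].
have m1 (x : R) : measurable (e @^-1` [set x]) by exact: measurable_funPTI.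
rewrite probability_setC; last exact: measurableU.
rewrite measureU//; last first.
  apply/seteqP; split => // w [/= -> /eqP].
  by rewrite -subr_eq0 opprK -mulr2n pnatr_eq0.
have -> : (P (e @^-1` [set 1%R]) + P (e @^-1` [set (-1)%R]) = 1)%E.
  by rewrite e1 eN1 -EFinD; congr EFin; lra.
by rewrite subee.
Qed.

(** By independence each sign vector has mass [2^-1 ^+ #|I|]. Only the masses of the values 1 and -1
    are prescribed, so other values may occur, but on a null set; hence [Q] needs to be checked only
    where every coordinate is a sign. *)
Lemma sign_event_le (R : realType) (d : measure_display)
    (T : measurableType d) (P : probability T R) (I : finType)
    (eps : I -> {RV P >-> R}) (Q : pred {ffun I -> bool}) (A : set T) :
  mutually_independent eps -> (forall i, uniform_sign (eps i)) ->
  measurable A ->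
  (forall w (s : {ffun I -> bool}), (forall i, eps i w = (-1) ^+ s i) -> A w -> Q s) ->
  (P A <= (\sum_(s | Q s) 2^-1 ^+ #|I|)%:E)%E.
Proof.
move=> indep unif mA AQ.
have m1 i (x : R) : measurable (eps i @^-1` [set x]) by exact: measurable_funPTI.
(* The atom of each sign vector, plus one null set per coordinate where it is not
   a sign. *)
pose F (x : I + {ffun I -> bool}) : set T := match x with
  | inl i => ~` (eps i @^-1` [set 1] `|` eps i @^-1` [set -1])
  | inr s => \bigcap_(i in [set` [set: I]%SET]) (eps i @^-1` [set (-1) ^+ s i])
  end.
pose Q' (x : I + {ffun I -> bool}) := if x is inr s then Q s else true.
have mF x : measurable (F x).
  case: x => [i|s] /=; first by apply: measurableC; exact: measurableU.
  exact: fin_bigcap_measurable.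
apply: (le_trans (@probability_le_sum _ _ _ P _ Q' A F mA mF _)).
  move=> w Aw; have [[i Ni]|noN] := pselect (exists i, F (inl i) w).
    by exists (inl i).
  (* [true] encodes the sign -1, as in [(-1) ^+ s i]; off the null sets a value other than -1 is
     1. *)
  pose s := [ffun i => eps i w == -1].
  have ws i : eps i w = (-1) ^+ s i.
    rewrite ffunE; case: eqP => // ne; rewrite expr0.
    by apply: contrapT => n1; apply: noN; exists i => -[].
  exists (inr s); first exact: AQ Aw.
  by move=> i _; exact: ws.
rewrite big_sumType/= big1 ?add0e; last by move=> i _; exact: uniform_sign_null.
rewrite -sumEFin; apply: lee_sum => s _.
rewrite indep//; under eq_bigr => i _.
  have -> : P (eps i @^-1` [set (-1) ^+ s i]) = (2^-1)%:E.
    by case: (unif i) => u1 uN1; case: (s i); rewrite ?expr0 ?expr1.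
  over.
by rewrite prodEFin prodr_const cardsT.
Qed.

(** * The Chernoff bound as a weighted count *)

Lemma rademacher_chernoff (R : realType) (I : finType) (a : I -> R) (t v : R) :
  0 <= t -> 0 < v -> \sum_i a i ^+ 2 <= v ->
  \sum_(s : {ffun I -> bool} | t <= `|\sum_i a i * (-1) ^+ s i|) 2^-1 ^+ #|I|
    <= 2 * expR (- (t ^+ 2 / (2 * v))).
Proof.
(* This [l] minimizes the Chernoff exponent [- (l * t) + l ^+ 2 * v / 2], with minimum
   [- (t ^+ 2 / (2 * v))]. *)
move=> t_ge0 v_gt0 a_le; pose l := t / v.
pose S (s : {ffun I -> bool}) := \sum_i a i * (-1) ^+ s i.
(* Applied below with [m = l] and [m = - l], one for each tail. *)
have mgf (m : R) : m ^+ 2 = l ^+ 2 ->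
    \sum_(s : {ffun I -> bool}) 2^-1 ^+ #|I| * expR (m * S s)
    <= expR (l ^+ 2 * v / 2).
  move=> ml.
  under eq_bigr => s _.
    rewrite mulr_sumr expR_sum -prodr_const -big_split /=; over.
  (* Distributivity turns the sum over sign vectors into a product over coordinates of two-term
     sums, each the cosh of [m * a i]. *)
  rewrite -(bigA_distr_bigA (fun i (b : bool) => 2^-1 * expR (m * (a i * (-1) ^+ b)))).
  have : \sum_i (m * a i) ^+ 2 / 2 <= l ^+ 2 * v / 2.
    rewrite -mulr_suml ler_pM2r ?invr_gt0//.
    under eq_bigr => i _ do rewrite exprMn ml.
    by rewrite -mulr_sumr ler_wpM2l ?sqr_ge0.
  rewrite -ler_expR expR_sum; apply: le_trans.
  apply: ler_prod => i _; rewrite big_bool /= expr0 expr1 mulr1 mulrN1 mulrN.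
  rewrite addr_ge0 ?mulr_ge0 ?expR_ge0 ?invr_ge0//=.
  rewrite -mulrDr ler_pdivrMl// addrC; exact: expRD_expRN_le.
(* If [s] is counted, then [S s] or its opposite is at least [t], so one of the two exponentials
   times [expR (- (l * t))] is at least 1. The other terms are nonnegative. *)
apply: (@le_trans _ _ (\sum_(s : {ffun I -> bool}) expR (- (l * t)) *
  (2^-1 ^+ #|I| * expR (l * S s) + 2^-1 ^+ #|I| * expR (- l * S s)))).
  rewrite big_mkcond; apply: ler_sum => s _.
  rewrite -mulrDr mulrCA.
  have p_ge0 : 0 <= 2^-1 ^+ #|I| :> R by rewrite exprn_ge0 ?invr_ge0.
  case: ifP => [tS|_]; last by rewrite !mulr_ge0 ?addr_ge0 ?expR_ge0.
  rewrite ler_peMr// mulrDr -!expRD.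
  have l_ge0 : 0 <= l by rewrite divr_ge0 // ltW.
  have ge1 (y : R) : t <= y -> 1 <= expR (- (l * t) + l * y).
    move=> ty; apply: le_trans (expR_ge1Dx _).
    by rewrite lerDl addrC subr_ge0 ler_wpM2l.
  move: tS; rewrite -/(S s) ler_normr => /orP[/ge1 le1|/ge1 le1].
    by apply: (le_trans le1); rewrite lerDl expR_ge0.
  by apply: (le_trans le1); rewrite mulrN mulNr lerDr expR_ge0.
rewrite -mulr_sumr big_split/=.
have -> : - (t ^+ 2 / (2 * v)) = - (l * t) + l ^+ 2 * v / 2.
  by rewrite /l; field; rewrite gt_eqF.
rewrite expRD mulrCA ler_wpM2l ?expR_ge0// mulr2n mulrDl !mul1r.
by rewrite lerD ?mgf ?sqrrN.
Qed.

(** * Measurability of threshold events and weighted sums *)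

Lemma measurable_ge (R : realType) (d : measure_display)
    (T : measurableType d) (f : T -> R) (c : R) :
  measurable_fun setT f -> measurable [set w | c <= f w].
Proof.
by move=> mf; rewrite -[X in measurable X]setTI; apply: measurable_fun_le.
Qed.

Lemma measurable_bigmax_ge (R : realType) (d : measure_display)
    (T : measurableType d) (I : finType) (f : I -> T -> R) (c : R) :
  (forall i, measurable_fun setT (f i)) ->
  measurable [set w | c <= \big[Num.max/0]_i f i w].
Proof.
move=> mf.
(* The first set, everything or empty, accounts for the default value 0 of the maximum. *)
rewrite (_ : mkset _ = [set w | c <= 0] `|` \bigcup_i [set w | c <= f i w]).
  apply: measurableU; first by apply: measurable_ge.
  by apply: fin_bigcup_measurable => // i _; exact: measurable_ge.
apply/seteqP; split => w /=.
  by move=> /bigmax_geP[?|[i _ ?]]; [left|right; exists i].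
by move=> [?|[i _ ?]]; apply/bigmax_geP; [left|right; exists i].
Qed.

Lemma measurable_weighted_sum (R : realType) (d : measure_display)
    (T : measurableType d) (P : probability T R) (I : finType)
    (eps : I -> {RV P >-> R}) (a : I -> R) :
  measurable_fun setT (fun w => \sum_i a i * eps i w).
Proof. by apply: measurable_sum => i; exact: measurable_funM. Qed.

(** * The tail of one entry and the union bound *)

Lemma rademacher_tail (R : realType) (d : measure_display)
    (T : measurableType d) (P : probability T R) (I : finType)
    (eps : I -> {RV P >-> R}) (a : I -> R) (t v : R) :
  mutually_independent eps -> (forall i, uniform_sign (eps i)) ->
  0 <= t -> 0 < v -> \sum_i a i ^+ 2 <= v ->
  (P [set w | (t <= `|\sum_i a i * eps i w|)%R]
    <= (2 * expR (- (t ^+ 2 / (2 * v))))%:E)%E.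
Proof.
move=> indep unif t_ge0 v_gt0 a_le.
pose Q (s : {ffun I -> bool}) := t <= `|\sum_i a i * (-1) ^+ s i|.
apply: (@le_trans _ _ (\sum_(s | Q s) 2^-1 ^+ #|I|)%:E).
  apply: (sign_event_le indep unif) => [|w s ws /=].
    apply: measurable_ge; apply: measurableT_comp => //.
    exact: measurable_weighted_sum.
  by rewrite /Q; under eq_bigr => i _ do rewrite ws.
by rewrite lee_fin rademacher_chernoff.
Qed.

Lemma sign_diag_entry (R : realType) (d : measure_display)
    (T : measurableType d) (P : probability T R) (m p n : nat)
    (eps : 'I_p -> {RV P >-> R}) (H : 'M[R]_(m, p)) (X : 'M[R]_(p, n)) w i j :
  (H *m sign_diag_mx eps w *m X) i j = \sum_k (H i k * X k j) * eps k w.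
Proof.
rewrite /sign_diag_mx mul_mx_diag mxE; apply: eq_bigr => k _.
by rewrite !mxE mulrAC.
Qed.

(** The event [A] is left abstract, and need only force some large entry, so that the same bound
    serves both norms. *)
Lemma entry_union_bound (R : realType) (d : measure_display)
    (T : measurableType d) (P : probability T R) (m p n : nat)
    (eps : 'I_p -> {RV P >-> R}) (H : 'M[R]_(m, p)) (X : 'M[R]_(p, n))
    (t v : R) (A : set T) :
  mutually_independent eps -> (forall i, uniform_sign (eps i)) ->
  0 <= t -> 0 < v -> (forall i k, H i k ^+ 2 <= v) ->
  (forall j, l2norm (col j X) = 1) ->
  measurable A ->
  (forall w, A w ->
    exists ij : 'I_m * 'I_n, t <= `|(H *m sign_diag_mx eps w *m X) ij.1 ij.2|) ->
  (P A <= ((m * n)%:R * (2 * expR (- (t ^+ 2 / (2 * v)))))%:E)%E.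
Proof.
move=> indep unif t_ge0 v_gt0 H_le X_unit mA AY.
pose F (ij : 'I_m * 'I_n) :=
  [set w | t <= `|\sum_k (H ij.1 k * X k ij.2) * eps k w|].
apply: (le_trans (@probability_le_sum _ _ _ P _ xpredT A F mA _ _)).
- move=> ij; apply: measurable_ge; apply: measurableT_comp => //.
  exact: measurable_weighted_sum.
- by move=> w /AY[ij tY]; exists ij => //; rewrite /F/= -sign_diag_entry.
apply: (@le_trans _ _ (\sum_(ij : 'I_m * 'I_n)
    (2 * expR (- (t ^+ 2 / (2 * v))))%:E)%E).
  apply: lee_sum => -[i j] _; apply: rademacher_tail => //=.
  have X1 : \sum_k X k j ^+ 2 = 1.
    have := X_unit j; rewrite /l2norm => /(congr1 (fun x => x ^+ 2)).
    rewrite expr1n sqr_sqrtr; last first.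
      by apply: sumr_ge0 => k _; apply: sumr_ge0 => l _; exact: sqr_ge0.
    by under eq_bigr => k _ do rewrite big_ord1 mxE.
  (* Writing [v] as [v] times the squared norm of the unit column allows a termwise comparison. *)
  rewrite -[leRHS]mulr1 -X1 mulr_sumr; apply: ler_sum => k _.
  by rewrite exprMn ler_wpM2r ?sqr_ge0.
by rewrite sumEFin lee_fin sumr_const card_prod !card_ord -[leLHS]mulr_natl.
Qed.

(** * Row norms, and entry bounds for the two transforms *)

Lemma l2norm_rowE (R : realType) (m n : nat) (A : 'M[R]_(m, n)) i :
  l2norm (row i A) = Num.sqrt (\sum_j A i j ^+ 2).
Proof. by rewrite /l2norm big_ord1; under eq_bigr do rewrite mxE. Qed.

(** Otherwise the squares in the row would sum to strictly less than [n%:R * t ^+ 2]; the strict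
    inequality between sums uses that there is at least one column. *)
Lemma l2norm_row_ge_entry (R : realType) (m n : nat) (A : 'M[R]_(m, n)) i (t : R) :
  (0 < n)%N -> 0 < t -> Num.sqrt n%:R * t <= l2norm (row i A) ->
  exists j, t <= `|A i j|.
Proof.
move=> n_gt0 t_gt0; rewrite leNgt l2norm_rowE => /negP tA.
apply: contrapT => /forallNP A_lt; apply: tA.
rewrite -[t]ger0_norm ?(ltW t_gt0)// -sqrtr_sqr -sqrtrM ?ler0n//.
rewrite ltr_sqrt ?mulr_gt0 ?exprn_gt0 ?ltr0n//.
rewrite mulr_natl -[n in ltRHS]card_ord -sumr_const; apply: ltr_sum.
  by apply/hasP; exists (Ordinal n_gt0); rewrite ?mem_index_enum.
move=> j _; rewrite -(real_normK (num_real (A i j))) ltr_sqr ?nnegrE ?(ltW t_gt0)//.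
by rewrite ltNge; apply/negP/A_lt.
Qed.

Lemma hadamard_entry_sqr (R : realType) (p : nat) (H : 'M[R]_p) i k :
  orthonormal_hadamard H -> H i k ^+ 2 = p%:R^-1.
Proof.
by move=> [H_pm _]; have [->|->] := H_pm i k;
  rewrite ?sqrrN exprVn sqr_sqrtr ?ler0n.
Qed.

Lemma dct_entry_sqr_le (R : realType) (p : nat) i k :
  dct_mx R p i k ^+ 2 <= 2 / p%:R.
Proof.
rewrite mxE exprMn sqr_sqrtr; last by case: ifP => _; rewrite divr_ge0.
rewrite -[leRHS]mulr1 ler_pM ?sqr_ge0//.
- by case: ifP => _; rewrite divr_ge0.
- by rewrite ler_wpM2r ?invr_ge0//; case: ifP => _; rewrite ?ler1n.
Qed.

(** * Measurability of the two norm events *)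

Lemma measurable_sign_diag_entry (R : realType) (d : measure_display)
    (T : measurableType d) (P : probability T R) (m p n : nat)
    (eps : 'I_p -> {RV P >-> R}) (H : 'M[R]_(m, p)) (X : 'M[R]_(p, n)) i j :
  measurable_fun setT (fun w => (H *m sign_diag_mx eps w *m X) i j).
Proof.
under eq_fun do rewrite sign_diag_entry.
exact: measurable_weighted_sum.
Qed.

Lemma measurable_mx_norm_ge (R : realType) (d : measure_display)
    (T : measurableType d) (m n : nat) (Y : T -> 'M[R]_(m, n)) (c : R) :
  (forall i j, measurable_fun setT (fun w => Y w i j)) ->
  measurable [set w | c <= mx_norm (Y w)].
Proof.
move=> mY; under eq_set do rewrite mx_normrE.
apply: (@measurable_bigmax_ge _ _ _ _ (fun ij w => `|Y w ij.1 ij.2|)) => ij.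
exact: measurableT_comp.
Qed.

Lemma measurable_max_row_norm_ge (R : realType) (d : measure_display)
    (T : measurableType d) (m n : nat) (Y : T -> 'M[R]_(m, n)) (c : R) :
  (forall i j, measurable_fun setT (fun w => Y w i j)) ->
  measurable [set w | c <= max_row_norm (Y w)].
Proof.
move=> mY.
apply: (@measurable_bigmax_ge _ _ _ _ (fun i w => l2norm (row i (Y w)))) => i.
under eq_fun do rewrite l2norm_rowE.
apply: measurableT_comp.
  by apply: continuous_measurable_fun; apply: sqrt_continuous.
by apply: measurable_sum => j; exact: measurable_funX.
Qed.

Theorem corollary2 (R : realType) (d : measure_display) (T : measurableType d)
    (P : probability T R) (p n : nat) (p_gt0 : (0 < p)%N) (n_gt0 : (0 < n)%N)
    (X : 'M[R]_(p, n)) (X_unit : forall j, l2norm (col j X) = 1)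
    (eps : 'I_p -> {RV P >-> R})
    (eps_indep : mutually_independent eps)
    (eps_unif : forall i, uniform_sign (eps i))
    (H : 'M[R]_p) (eta : R)
    (H_eta : (orthonormal_hadamard H /\ eta = 1) \/
             (H = dct_mx R p /\ eta = 1 / 2)) :
  let Y := fun w : T => H *m sign_diag_mx eps w *m X in
  forall alpha : R, 0 < alpha < 1 ->
    (P [set w | ((1 / Num.sqrt p%:R) *
                 Num.sqrt (2 / eta * ln (2 * n%:R * p%:R / alpha))
               <= mx_norm (Y w))%R] <= alpha%:E)%E
    /\
    (P [set w | (Num.sqrt (n%:R / p%:R) *
                 Num.sqrt (2 / eta * ln (2 * n%:R * p%:R / alpha))
               <= max_row_norm (Y w))%R] <= alpha%:E)%E.
Proof.
move=> Y alpha /andP[alpha_gt0 alpha_lt1].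
have eta_gt0 : 0 < eta by case: H_eta => -[_ ->]; rewrite ?divr_gt0.
(* One variance proxy covers both cases: it is 1/p for Hadamard and 2/p for the DCT. *)
have H_le i k : H i k ^+ 2 <= (eta * p%:R)^-1.
  case: H_eta => -[HE ->]; first by rewrite mul1r (hadamard_entry_sqr _ _ HE).
  by rewrite HE mul1r invfM invrK dct_entry_sqr_le.
have p0 : 0 < p%:R :> R by rewrite ltr0n.
have n0 : 0 < n%:R :> R by rewrite ltr0n.
set L := ln _; set t := 1 / _ * _.
have ratio_gt1 : 1 < 2 * n%:R * p%:R / alpha.
  rewrite ltr_pdivlMr// mul1r (lt_le_trans alpha_lt1)//.
  by rewrite -!natrM ler1n !muln_gt0 n_gt0.
have L_gt0 : 0 < L by rewrite ln_gt0.
have B_gt0 : 0 < 2 / eta * L by rewrite mulr_gt0// divr_gt0.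
(* Strict positivity rules out the default 0 of both maxima in the last steps. *)
have t_gt0 : 0 < t by rewrite mulr_gt0 ?divr_gt0 ?sqrtr_gt0.
have rowE : Num.sqrt (n%:R / p%:R) * Num.sqrt (2 / eta * L) = Num.sqrt n%:R * t.
  by rewrite sqrtrM ?ler0n// sqrtrV ?ler0n// /t div1r mulrA.
(* The threshold makes the exponent exactly [- L], so each of the np entries contributes [alpha] /
   (np). *)
have boundE : (p * n)%:R * (2 * expR (- (t ^+ 2 / (2 * (eta * p%:R)^-1)))) = alpha.
  have -> : t ^+ 2 / (2 * (eta * p%:R)^-1) = L.
    rewrite /t exprMn expr_div_n !sqr_sqrtr ?(ltW p0) ?(ltW B_gt0)//.
    by field; rewrite !gt_eqF.
  rewrite expRN lnK ?posrE ?(lt_trans ltr01)// natrM.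
  by field; rewrite !gt_eqF.
have mY i j : measurable_fun setT (fun w => Y w i j).
  exact: measurable_sign_diag_entry.
have v_gt0 : 0 < (eta * p%:R)^-1 by rewrite invr_gt0 mulr_gt0.
rewrite -[alpha in alpha%:E]boundE rowE.
split; apply: (entry_union_bound eps_indep eps_unif (ltW t_gt0) v_gt0 H_le X_unit).
- exact: measurable_mx_norm_ge.
- move=> w /=; rewrite mx_normrE => /bigmax_geP[|[ij _ tY]]; last by exists ij.
  by rewrite leNgt t_gt0.
- exact: measurable_max_row_norm_ge.
- move=> w /= /bigmax_geP[|[i _ /(l2norm_row_ge_entry n_gt0 t_gt0)[j tY]]].
    by rewrite leNgt mulr_gt0 ?sqrtr_gt0.
  by exists (i, j).
Qed.
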